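(* For all integers $n\ge 0$ and all integers $k\ge j\ge 0$, \[ a_{9(k-j)+5,\;9k+1}(9n+6)\equiv 0 \pmod 3. \]
   Context: For positive integers $r,s$, $a_{r,s}(n)$ denotes the number of multicolored partitions of $n$ in which each even part may appear in one of $r$ colors and each odd part may appear in one of $s$ colors (copies of the same part size in different colors are distinct), with $a_{r,s}(0)=1$. Equivalently, for $|q|<1$, $\sum_{n\ge0}a_{r,s}(n)q^n = f_2^{s-r}/f_1^{s}$, where $f_m=\prod_{i\ge1}(1-q^{mi})$. *)

(* Defs.v *)
From mathcomp Require Import all_boot.

Set Implicit Arguments.
Unset Strict Implicit.
Unset Printing Implicit Defensive.

Definition num_colors (r s i : nat) : nat := if odd i then s else r.

(* The ordinal i stands for the part size i.+1, so that sizes run over 1..n. *)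
Definition colored_part (r s n : nat) : finType :=
  {i : 'I_n & 'I_(num_colors r s i.+1)}.

Definition part_size (r s n : nat) (p : colored_part r s n) : nat :=
  (tag p).+1.

(* A multicolored partition of n is a finite multiset of colored parts of total
   size n, given by its multiplicity function; part sizes and multiplicities
   are necessarily at most n. *)
Definition multicolored_partitions (r s n : nat) :
    {set {ffun colored_part r s n -> 'I_n.+1}} :=
  [set m : {ffun colored_part r s n -> 'I_n.+1} |
    \sum_(p : colored_part r s n) m p * part_size p == n].

Definition a (r s n : nat) : nat := #|multicolored_partitions r s n|.

(* Main.v *)
Require Import Defs.
From mathcomp Require Import all_boot all_algebra.
From mathcomp Require Import ring zify.

(**
Work with power series over [F_3], truncated modulo [X^N]. Write
[f_m = prod (1 - q^(m i))], [psi = sum_(l in Z) q^(l (l - 1) / 2)] and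
[B = sum_(l in Z) (q^(l (3 l - 1) / 2) + q^(l (3 l + 1) / 2))]. Jacobi's triple
product gives [psi f_1 = 2 f_2^2] and [B f_1 f_6 = 2 f_3^2 f_2]; splitting [l]
modulo 3 gives [psi(q) = q psi(q^9) + B(q^3)]. In characteristic 3, [u^3] is
[u(q^3)], so the generating function [G] satisfies [2 G W(q^9) = f_2(q^3) psi]
for some [W] with nonzero constant term, and the coefficients of [G] at
[9 n + 6] vanish once those of [f_2 B] at [3 n + 2] do. This holds because
[B f_2 f_2(q^3) = psi f_1(q^3)^2] and no triangular number is 2 modulo 3.
The triple product is the limit of the finite q-binomial theorem for
[prod_(i < 2 m) (q^m + z q^i)].
*)

Set Implicit Arguments.
Unset Strict Implicit.
Unset Printing Implicit Defensive.

Import GRing.Theory.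
Local Open Scope ring_scope.

(** * Gaussian binomials and the finite q-binomial theorem *)

Section QBinomial.

Variables (R : comNzRingType) (q : R).

(* The exponent [n - k] is truncated only when [n < k], where [qbin n k = 0]. *)
Fixpoint qbin (n k : nat) {struct n} : R :=
  match n, k with
  | _, 0 => 1
  | 0, k'.+1 => 0
  | n'.+1, k'.+1 => qbin n' k'.+1 + q ^+ (n' - k') * qbin n' k'
  end.

Definition qfact (n : nat) : R := \prod_(i < n) (1 - q ^+ i.+1).

Lemma qbin0 n : qbin n 0 = 1. Proof. by case: n. Qed.

Lemma qbinS n k :
  qbin n.+1 k.+1 = qbin n k.+1 + q ^+ (n - k) * qbin n k.
Proof. by []. Qed.

Arguments qbin : simpl never.

Lemma qbin_small n k : (n < k)%N -> qbin n k = 0.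
Proof.
elim: n k => [|n IHn] [|k] // lt_nk; rewrite qbinS.
by rewrite !IHn ?mulr0 ?addr0 //; lia.
Qed.

Lemma qfactS n : qfact n.+1 = qfact n * (1 - q ^+ n.+1).
Proof. by rewrite /qfact big_ord_recr. Qed.

Lemma qbin_qfact n k : (k <= n)%N ->
  qbin n k * (qfact k * qfact (n - k)) = qfact n.
Proof.
elim: n k => [|n IHn] [|k] //.
- by move=> _; rewrite qbin0 /qfact !big_ord0 !mul1r.
- by move=> _; rewrite qbin0 subn0 {1}/qfact big_ord0 !mul1r.
move=> le_kn; rewrite qbinS subSS qfactS.
(* The two summands of [1 - q^(n+1) = (1 - q^(n-k)) + q^(n-k) (1 - q^(k+1))] match the two terms of
   the Pascal rule. For [k = n] the first one is zero. *)
have -> : qfact n.+1 = (1 - q ^+ (n - k)) * qfact n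
    + q ^+ (n - k) * (1 - q ^+ k.+1) * qfact n.
  rewrite qfactS; have -> : n.+1 = ((n - k) + k.+1)%N by lia.
  by rewrite exprD; ring.
rewrite -{2}(IHn k) //.
have [lt_kn|ge_kn] := ltnP k n.
  rewrite -(IHn k.+1) //.
  have -> : (n - k)%N = (n - k.+1).+1 by lia.
  by rewrite !qfactS; ring.
have -> : (n - k)%N = 0%N by lia.
by rewrite qbin_small //; ring.
Qed.

Lemma qbinomial_theorem (x y : R) n :
  \prod_(i < n) (x + y * q ^+ i) =
  \sum_(k < n.+1) qbin n k * q ^+ 'C(k, 2) * y ^+ k * x ^+ (n - k).
Proof.
elim: n => [|n IHn].
  by rewrite big_ord0 big_ord1 qbin0 bin0n !mulr1.
rewrite big_ord_recr IHn /= mulrDr.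
rewrite [RHS]big_ord_recl.
under [in RHS]eq_bigr => i _.
  rewrite lift0 qbinS 3!mulrDl.
  over.
rewrite big_split /= addrA; congr (_ + _).
  rewrite big_ord_recl mulrDl [X in _ + X = _]mulr_suml.
  rewrite [in RHS]big_ord_recr /= (@qbin_small n n.+1) // !mul0r addr0.
  congr (_ + _); first by rewrite !qbin0 !subn0 exprS; ring.
  apply: eq_bigr => i _; rewrite /bump leq0n add1n subSS.
  have -> : (n - i)%N = (n - i.+1).+1 by have := ltn_ord i; lia.
  by rewrite (exprS x); ring.
rewrite mulr_suml; apply: eq_bigr => i _; rewrite subSS.
have -> : 'C(i.+1, 2) = (i + 'C(i, 2))%N by rewrite binS bin1 addnC.
have := ltn_ord i; rewrite ltnS => le_in.
have -> : q ^+ n = q ^+ (n - i) * q ^+ i by rewrite -exprD subnK.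
by rewrite !exprD (exprS y); ring.
Qed.

End QBinomial.

(** * Polynomial congruences modulo a power of ['X] *)

Section TruncatedCongruence.

Variable F : fieldType.
Implicit Types (p r t : {poly F}) (N : nat).

Definition eqX N p r : bool := 'X^N %| p - r.

Lemma eqX_refl N p : eqX N p p.
Proof. by rewrite /eqX subrr dvdp0. Qed.

Lemma eqX_sym N p r : eqX N p r -> eqX N r p.
Proof. by rewrite /eqX -opprB dvdpNr. Qed.

Lemma eqX_trans N r p t : eqX N p r -> eqX N r t -> eqX N p t.
Proof.
move=> pr rt; rewrite /eqX; have -> : p - t = (p - r) + (r - t) by ring.
exact: dvdp_add.
Qed.

Lemma eqXD N p1 r1 p2 r2 :
  eqX N p1 r1 -> eqX N p2 r2 -> eqX N (p1 + p2) (r1 + r2).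
Proof.
move=> e1 e2; rewrite /eqX.
have -> : p1 + p2 - (r1 + r2) = (p1 - r1) + (p2 - r2) by ring.
exact: dvdp_add.
Qed.

Lemma eqXM N p1 r1 p2 r2 :
  eqX N p1 r1 -> eqX N p2 r2 -> eqX N (p1 * p2) (r1 * r2).
Proof.
move=> e1 e2; rewrite /eqX.
have -> : p1 * p2 - r1 * r2 = (p1 - r1) * p2 + r1 * (p2 - r2) by ring.
by apply: dvdp_add; [apply: dvdp_mulr|apply: dvdp_mull].
Qed.

Lemma eqXMl N t p r : eqX N p r -> eqX N (t * p) (t * r).
Proof. exact: eqXM (eqX_refl N t). Qed.

Lemma eqXX N p r n : eqX N p r -> eqX N (p ^+ n) (r ^+ n).
Proof.
move=> e; elim: n => [|n IHn]; first exact: eqX_refl.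
by rewrite !exprS; apply: eqXM.
Qed.

Lemma eqX_prod N (I : Type) (s : seq I) (P : pred I) (u v : I -> {poly F}) :
  (forall i, P i -> eqX N (u i) (v i)) ->
  eqX N (\prod_(i <- s | P i) u i) (\prod_(i <- s | P i) v i).
Proof.
move=> e; elim/big_ind2: _ => //; first exact: eqX_refl.
by move=> *; apply: eqXM.
Qed.

Lemma eqX_sum N (I : Type) (s : seq I) (P : pred I) (u v : I -> {poly F}) :
  (forall i, P i -> eqX N (u i) (v i)) ->
  eqX N (\sum_(i <- s | P i) u i) (\sum_(i <- s | P i) v i).
Proof.
move=> e; elim/big_ind2: _ => //; first exact: eqX_refl.
by move=> *; apply: eqXD.
Qed.

Lemma eqX_coef N p r i : eqX N p r -> (i < N)%N -> p`_i = r`_i.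
Proof.
case/dvdpP=> t e lt_iN; apply/eqP; rewrite -subr_eq0 -coefB e.
by rewrite coefMXn lt_iN.
Qed.

(** A factor with nonzero constant term is coprime to ['X]. This replaces the inversion of power
    series. *)
Lemma eqX_cancel N t p r : t`_0 != 0 -> eqX N (t * p) (t * r) -> eqX N p r.
Proof.
move=> t0; rewrite /eqX -mulrBr Gauss_dvdpr //.
rewrite coprimep_expl // coprimep_sym -['X]subr0 -(polyC0 F) coprimep_XsubC.
by rewrite rootE horner_coef0.
Qed.

Lemma eqX_weaken N M p r : (N <= M)%N -> eqX M p r -> eqX N p r.
Proof. by move=> le_NM; apply: dvdp_trans; rewrite dvdp_exp2l. Qed.

Lemma eqX_MXn N M p r e : eqX M p r -> (N <= M + e)%N ->
  eqX N (p * 'X^e) (r * 'X^e).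
Proof.
move=> pr le; apply: (eqX_weaken le).
by rewrite /eqX -mulrBl exprD dvdp_mul.
Qed.

Lemma eqX_1subXn N n : (N <= n)%N -> eqX N (1 - 'X^n) (1 : {poly F}).
Proof.
move=> le_Nn; rewrite /eqX; have -> : 1 - 'X^n - 1 = - 'X^n :> {poly F} by ring.
by rewrite dvdpNr dvdp_exp2l.
Qed.

Lemma modnB_dvd d i j : (d %| j)%N -> (j <= i)%N -> i - j = i %[mod d].
Proof.
move=> dj ji; apply/eqP; rewrite -(eqn_modDr j) subnK // -modnDmr.
by move: dj; rewrite /dvdn => /eqP ->; rewrite addn0.
Qed.

(** A factor in ['X^d] shifts exponents by multiples of [d] only. *)
Lemma coef_mul_comp_Xn d c p (u : {poly F}) : (0 < d)%N ->
  (forall i, i = c %[mod d] -> p`_i = 0) ->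
  forall i, i = c %[mod d] -> (p * (u \Po 'X^d))`_i = 0.
Proof.
move=> d_gt0 p0 i ic; rewrite coefMr big1 // => j _.
rewrite coef_comp_poly_Xn //; case: ifP => [dj|_]; last by rewrite mulr0.
by rewrite p0 ?mul0r // modnB_dvd // -ltnS.
Qed.

(** Coefficient [i] of the product is [u_0 p_i] plus multiples of earlier coefficients of [p] in the
    same residue class, so strong induction applies. *)
Lemma coef_div_comp_Xn N d c p r (u : {poly F}) : (0 < d)%N -> u`_0 != 0 ->
  eqX N (p * (u \Po 'X^d)) r ->
  (forall i, (i < N)%N -> i = c %[mod d] -> r`_i = 0) ->
  forall i, (i < N)%N -> i = c %[mod d] -> p`_i = 0.
Proof.
move=> d_gt0 u0 e r0; elim/ltn_ind => i IHi lt_iN ic.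
have := eqX_coef e lt_iN; rewrite r0 // coefMr big_ord_recl subn0 big1.
  rewrite addr0 coef_comp_poly_Xn // dvdn0 div0n => /eqP.
  by rewrite mulf_eq0 (negPf u0) orbF => /eqP.
move=> j _; rewrite coef_comp_poly_Xn // lift0.
case: ifP => [dj|_]; last by rewrite mulr0.
have lt_ji := ltn_ord j.
by rewrite IHi ?mul0r ?modnB_dvd //; lia.
Qed.

End TruncatedCongruence.

(** * Jacobi's triple product, truncated *)

Section TripleProduct.

Variable F : fieldType.
Implicit Types (N m : nat).

Definition euler (d M : nat) : {poly F} := \prod_(i < M) (1 - 'X^(d * i.+1)).

(** The factors [(1 + z q^i) (1 + z^-1 q^(i+1))] of the triple product at [q = 'X^(b + b')] and
    [z = 'X^b]. *)
Definition triple_factor (b b' m : nat) : {poly F} :=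
  \prod_(i < m) ((1 + 'X^(b + (b + b') * i)) * (1 + 'X^(b' + (b + b') * i))).

(* With [l = k - m], the integer [a l (l - 1) / 2 + b l] for [a = b + b']. *)
Definition theta_exp (b b' m k : nat) : nat :=
  if (m <= k)%N then ((b + b') * 'C(k - m, 2) + b * (k - m))%N
  else ((b + b') * 'C(m - k, 2) + b' * (m - k))%N.

Definition theta (b b' m : nat) : {poly F} :=
  \sum_(k < m.*2.+1) 'X^(theta_exp b b' m k).

Lemma euler_qfact d M : euler d M = qfact 'X^d M.
Proof. by apply: eq_bigr => i _; rewrite exprM. Qed.

Lemma euler0 d M : (0 < d)%N -> (euler d M)`_0 = 1.
Proof.
move=> d_gt0; rewrite -horner_coef0 horner_prod big1 // => i _.
by rewrite !hornerE expr0n muln_eq0 -leqn0 leqNgt d_gt0 subr0.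
Qed.

Lemma eulerS d M : euler d M.+1 = euler d M * (1 - 'X^(d * M.+1)).
Proof. by rewrite /euler big_ord_recr. Qed.

Lemma euler_tail N d M M' : (N <= d * M.+1)%N -> (N <= d * M'.+1)%N ->
  eqX N (euler d M) (euler d M').
Proof.
wlog le_MM : M M' / (M <= M')%N => [hw|].
  case/orP: (leq_total M M') => ? ? ?; first exact: hw.
  by apply: eqX_sym; apply: hw.
move=> hM _; rewrite -(subnKC le_MM); elim: (M' - M)%N => [|j IHj].
  by rewrite addn0 eqX_refl.
rewrite addnS eulerS -[X in eqX _ X _]mulr1; apply: eqXM => //.
by apply/eqX_sym/eqX_1subXn; apply: leq_trans hM _; rewrite leq_mul2l; lia.
Qed.

Lemma bin2D m n : ('C(m + n, 2) = 'C(m, 2) + 'C(n, 2) + m * n)%N.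
Proof.
elim: m => [|m IHm]; first by rewrite add0n mul0n addn0.
by rewrite addSn !binS IHm !bin1; lia.
Qed.

Lemma bin2_sqr n : ('C(n, 2) * 2 + n = n * n)%N.
Proof. by elim: n => // n IHn; rewrite binS bin1; lia. Qed.

(** The left side is the exponent of term [k] in the q-binomial expansion below; it differs from the
    theta exponent by an amount independent of [k]. *)
Lemma theta_exp_shift b b' m k : (k <= m.*2)%N ->
  ((b + b') * 'C(k, 2) + b * k + (b + b') * m * (m.*2 - k) =
   (b + b') * ('C(m, 2) + m * m) + b * m + theta_exp b b' m k)%N.
Proof.
rewrite /theta_exp -addnn => le_k; case: leqP => [le_mk|lt_km].
  move: le_k; rewrite -(subnKC le_mk); move: (k - m)%N => l le_l.
  rewrite addKn bin2D subnDl.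
  have -> : (m * m = m * l + m * (m - l))%N by rewrite -mulnDr subnKC; lia.
  by ring.
rewrite -(subnKC (ltnW lt_km)); move: (m - k)%N => p.
rewrite bin2D addKn; have := bin2_sqr p.
have -> : (k + p + (k + p) - k = k + 2 * p)%N by lia.
move: 'C(p, 2) 'C(k, 2) => c d e.
have -> : ((b + b') * d + b * k + (b + b') * (k + p) * (k + 2 * p) =
  (b + b') * (d + k * p + (k + p) * (k + p)) + b * k + (b + b') * (p * p))%N by ring.
by rewrite -e; ring.
Qed.

Lemma triple_factor_qbin b b' m :
  triple_factor b b' m =
  \sum_(k < m.*2.+1) qbin 'X^(b + b') m.*2 k * 'X^(theta_exp b b' m k).
Proof.
set a := (b + b')%N; set c := (a * ('C(m, 2) + m * m) + b * m)%N.
have Xc0 : 'X^c != 0 :> {poly F} by rewrite expf_neq0 ?polyX_eq0.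
apply: (mulfI Xc0).
(* Pulling ['X^(b + a i)] out of each of the first [m] factors and ['X^(a m)] out of each of the
   others leaves [triple_factor]; the powers removed multiply to ['X^c]. *)
transitivity (\prod_(i < m.*2) ('X^(a * m) + 'X^b * 'X^a ^+ i) : {poly F}).
  have -> : 'X^c = (\prod_(i < m) 'X^(b + a * (m - i.+1))) *
      \prod_(i < m) 'X^(a * m) :> {poly F}.
    rewrite [X in _ = X * _](reindex_inj rev_ord_inj) /= -!expr_sum -exprD.
    congr ('X^ _); under [in RHS]eq_bigr => i _.
      have -> : (m - (m - i.+1).+1 = i)%N by have := ltn_ord i; lia.
      over.
    rewrite !big_split /= -big_distrr /= !sum_nat_const card_ord.
    by rewrite -(big_mkord xpredT id) bin2_sum /c; ring.
  rewrite -addnn big_split_ord /= /triple_factor -/a !big_split /=.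
  rewrite [X in _ * X = _]mulrC mulrACA; congr (_ * _); rewrite -big_split /=.
    rewrite [in RHS](reindex_inj rev_ord_inj) /=.
    apply: eq_bigr => i _; rewrite mulrDr mulr1 -exprM -!exprD addrC.
    congr ('X^ _ + _); rewrite addnACA -mulnDr -/a -mulnS.
    by congr muln; have := ltn_ord i; lia.
  apply: eq_bigr => i _; rewrite mulrDr mulr1 -exprM -!exprD.
  by congr (_ + 'X^ _); ring.
rewrite qbinomial_theorem mulr_sumr; apply: eq_bigr => k _.
rewrite mulrCA -!mulrA; congr (_ * _).
rewrite -!exprM -!exprD -theta_exp_shift; last by rewrite -ltnS.
by congr ('X^ _); rewrite addnA.
Qed.

(** The Gaussian binomial tends to [1 / f_a]: the Euler products in [qbin_qfact] all agree with
    [euler a m] up to the precision set by the smallest index. *)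
Lemma qbin_euler a m k : (0 < a)%N -> (k <= m.*2)%N ->
  eqX (a * (minn k (m.*2 - k)).+1) (qbin 'X^a m.*2 k * euler a m) 1.
Proof.
move=> a_gt0 le_k; set N := (a * _)%N.
have e0 := euler0 m a_gt0.
apply: (@eqX_cancel _ _ (euler a m)); first by rewrite e0 oner_eq0.
have tail M : ((minn k (m.*2 - k)) <= M)%N -> eqX N (euler a m) (euler a M).
  by move=> h; apply: euler_tail; rewrite leq_mul2l; lia.
apply: (@eqX_trans _ _ (qbin 'X^a m.*2 k * (euler a k * euler a (m.*2 - k)))).
  rewrite mulrCA; apply: eqXMl; apply: eqXM; apply: tail; lia.
rewrite !euler_qfact qbin_qfact // -!euler_qfact mulr1.
by apply: eqX_sym; apply: tail; lia.
Qed.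

Lemma triple_product N b b' m : (0 < b + b')%N -> (N <= (b + b') * m)%N ->
  eqX N (triple_factor b b' m * euler (b + b') m) (theta b b' m).
Proof.
move=> a_gt0 le_N; rewrite triple_factor_qbin mulr_suml; apply: eqX_sum => k _.
rewrite mulrAC -['X^(theta_exp _ _ _ _) in X in eqX _ _ X]mul1r.
have := ltn_ord k; rewrite ltnS => le_k.
(* Precision drops as [p = |k - m|] grows, but the factor ['X^(theta_exp b b' m k)] makes up for it,
   because [p <= 'C(p, 2) + 1]. *)
apply: (eqX_MXn (qbin_euler a_gt0 le_k)); apply: (leq_trans le_N).
have le_bin p : (p <= ('C(p, 2)).+1)%N by have := bin2_sqr p; case: p => // p; nia.
rewrite /theta_exp; case: (leqP m k) => h; rewrite addnA;
  apply: leq_trans (leq_addr _ _); rewrite -mulnDr leq_mul2l.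
  by have := le_bin (k - m)%N; lia.
by have := le_bin (m - k)%N; lia.
Qed.

End TripleProduct.

(** * Trisection and product formulas of the theta series *)

Lemma big_ord_mul3 (R : Type) (idx : R) (op : Monoid.law idx) n (f : nat -> R) :
  \big[op/idx]_(k < 3 * n) f k =
  \big[op/idx]_(k < n) op (op (f (3 * k)%N) (f (3 * k).+1)) (f (3 * k).+2).
Proof.
elim: n => [|n IHn]; first by rewrite muln0 !big_ord0.
have -> : (3 * n.+1 = (3 * n).+3)%N by lia.
by rewrite !big_ord_recr /= IHn !Monoid.mulmA.
Qed.

Section ThetaIdentities.

Variable F : fieldType.

Definition euler_pos (d M : nat) : {poly F} :=
  \prod_(i < M) (1 + 'X^(d * i.+1)).

Lemma euler_pos_euler d M : euler_pos d M * euler F d M = euler F (d * 2) M.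
Proof.
rewrite -big_split; apply: eq_bigr => i _ /=.
have -> : (d * 2 * i.+1 = d * i.+1 + d * i.+1)%N by lia.
by rewrite exprD; ring.
Qed.

(** Put [t = k - M]. Index [3 * k] corresponds to [l = 3t - 1], where [l(l-1)/2 = 9 t(t-1)/2 + 1].
    The next two lemmas treat [l = 3t] and [l = 3t + 1], which give three times [t(3t-1)/2] and
    [t(3t+1)/2]. *)
Lemma theta_exp_mod3_0 M k :
  theta_exp 0 1 (3 * M).+1 (3 * k) = (9 * theta_exp 0 1 M k).+1.
Proof.
rewrite /theta_exp; case: (leqP M k) => h1; case: (leqP _ (3 * k)) => h2;
  try lia.
- have := bin2_sqr (k - M); have := bin2_sqr (3 * k - (3 * M).+1).
  have -> : (3 * k - (3 * M).+1 = 3 * (k - M) - 1)%N by lia.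
  by nia.
- have -> : k = M by lia.
  by rewrite subSnn subnn.
have := bin2_sqr (M - k); have := bin2_sqr ((3 * M).+1 - 3 * k).
have -> : ((3 * M).+1 - 3 * k = 3 * (M - k) + 1)%N by lia.
by nia.
Qed.

Lemma theta_exp_mod3_1 M k :
  theta_exp 0 1 (3 * M).+1 (3 * k).+1 = (3 * theta_exp 1 2 M k)%N.
Proof.
rewrite /theta_exp ltnS leq_pmul2l // !subSS -!mulnBr; case: leqP => h.
  by have := bin2_sqr (k - M); have := bin2_sqr (3 * (k - M)); nia.
by have := bin2_sqr (M - k); have := bin2_sqr (3 * (M - k)); nia.
Qed.

Lemma theta_exp_mod3_2 M k :
  theta_exp 0 1 (3 * M).+1 (3 * k).+2 = (3 * theta_exp 2 1 M k)%N.
Proof.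
rewrite /theta_exp !subSS; case: (leqP M k) => h1; case: leqP => h2; try lia.
  have := bin2_sqr (k - M); have := bin2_sqr ((3 * k).+1 - 3 * M).
  have -> : ((3 * k).+1 - 3 * M = 3 * (k - M) + 1)%N by lia.
  by nia.
have := bin2_sqr (M - k); have := bin2_sqr (3 * M - (3 * k).+1).
have -> : (3 * M - (3 * k).+1 = 3 * (M - k) - 1)%N by lia.
by nia.
Qed.

Lemma theta_trisection M :
  theta F 0 1 (3 * M).+1 =
  'X * (theta F 0 1 M \Po 'X^9) +
  ((theta F 1 2 M + theta F 2 1 M) \Po 'X^3).
Proof.
(* With centre [3 * M + 1] the index range consists of full blocks of three. *)
rewrite /theta; have -> : ((3 * M).+1.*2.+1 = 3 * M.*2.+1)%N by lia.
rewrite (big_ord_mul3 _ _ (fun k => 'X^(theta_exp 0 1 (3 * M).+1 k))) /=.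
rewrite comp_polyD !raddf_sum /= mulr_sumr -!big_split /=.
apply: eq_bigr => k _; rewrite !comp_Xn_poly -!exprM -exprS -addrA.
by rewrite theta_exp_mod3_0 theta_exp_mod3_1 theta_exp_mod3_2.
Qed.

Lemma theta01_euler N m : (N <= m)%N ->
  eqX N (theta F 0 1 m.+1 * euler F 1 m) (2%:R * euler F 2 m ^+ 2).
Proof.
move=> le_Nm.
(* The 2 is the factor [1 + 'X^0]; splitting it off shortens one of the two products to length
   [m]. *)
have h : triple_factor F 0 1 m.+1 = 2%:R * euler_pos 1 m * euler_pos 1 m.+1.
  by rewrite /triple_factor big_split /= big_ord_recl /= muln0 expr0.
apply: (@eqX_trans _ _ (triple_factor F 0 1 m.+1 * euler F 1 m.+1 * euler F 1 m)).
  apply: eqXM (eqX_refl _ _); apply: eqX_sym; apply: (@triple_product _ _ 0 1) => //.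
  by rewrite mul1n leqW.
rewrite h; have -> : 2%:R * euler_pos 1 m * euler_pos 1 m.+1 * euler F 1 m.+1 * euler F 1 m
  = 2%:R * ((euler_pos 1 m.+1 * euler F 1 m.+1) * (euler_pos 1 m * euler F 1 m)) by ring.
rewrite !euler_pos_euler mul1n expr2; apply/eqXMl/eqXM; last exact: eqX_refl.
by apply: euler_tail; lia.
Qed.

Lemma triple_factorC b b' m : triple_factor F b b' m = triple_factor F b' b m.
Proof. by apply: eq_bigr => i _; rewrite mulrC (addnC b b'). Qed.

Lemma triple_factor12 m : triple_factor F 1 2 m * euler_pos 3 m = euler_pos 1 (3 * m).
Proof.
rewrite /euler_pos (big_ord_mul3 _ _ (fun k => 1 + 'X^(1 * k.+1))) -big_split /=.
by apply: eq_bigr => i _; congr (_ * _ * _); congr (_ + 'X^ _); lia.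
Qed.

(** The two series have the same product, by symmetry in [b] and [b']; hence the 2. The factor
    [euler_pos 3 m] of [f_6] supplies the exponents divisible by 3 that [triple_factor F 1 2 m]
    lacks. *)
Lemma theta12_euler N m : (N <= m)%N ->
  eqX N ((theta F 1 2 m + theta F 2 1 m) * euler F 1 (3 * m) * euler F 6 m)
    (2%:R * euler F 3 m ^+ 2 * euler F 2 (3 * m)).
Proof.
move=> le_Nm.
apply: (@eqX_trans _ _ ((triple_factor F 1 2 m * euler F 3 m
    + triple_factor F 2 1 m * euler F 3 m) * euler F 1 (3 * m) * euler F 6 m)).
  do 2![apply: eqXM (eqX_refl _ _)]; apply: eqXD; apply: eqX_sym.
    by apply: (@triple_product _ _ 1 2) => //; lia.
  by apply: (@triple_product _ _ 2 1) => //; lia.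
rewrite (triple_factorC 2 1).
have -> : euler F 6 m = euler_pos 3 m * euler F 3 m.
  by rewrite euler_pos_euler.
have -> : euler F 2 (3 * m) = triple_factor F 1 2 m * euler_pos 3 m * euler F 1 (3 * m).
  by rewrite triple_factor12 euler_pos_euler.
set x := (X in eqX _ X _); set y := (X in eqX _ _ X).
by have -> : x = y; [rewrite /x /y; ring|apply: eqX_refl].
Qed.

End ThetaIdentities.

(** * Cubing over ['F_3] *)

Lemma F3_3 : 3%:R = 0 :> 'F_3.
Proof. exact/val_inj. Qed.

Lemma polyF3_3 : 3%:R = 0 :> {poly 'F_3}.
Proof. by rewrite -polyC_natr F3_3. Qed.

Lemma F3_cube (c : 'F_3) : c ^+ 3 = c.
Proof. by case: c => [[|[|[|c]]]] //= h; apply/val_inj. Qed.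

Lemma polyF3_cube (p : {poly 'F_3}) : p ^+ 3 = p \Po 'X^3.
Proof.
elim/poly_ind: p => [|p c IHp]; first by rewrite comp_poly0 expr0n.
rewrite comp_polyD comp_polyM comp_polyX comp_polyC -IHp -{2}(F3_cube c).
rewrite polyC_exp; set d := c%:P.
have -> : (p * 'X + d) ^+ 3 =
  p ^+ 3 * 'X^3 + d ^+ 3 + 3%:R * (p * 'X * d * (p * 'X + d)) by ring.
by rewrite polyF3_3 mul0r addr0.
Qed.

Lemma polyF3_exp9 (p : {poly 'F_3}) : p ^+ 9 = p \Po 'X^9.
Proof.
have -> : 9%N = (3 * 3)%N by [].
rewrite !exprM (polyF3_cube p) (polyF3_cube (_ \Po _)).
by rewrite -comp_polyA comp_Xn_poly.
Qed.

Lemma euler_cube d M : euler 'F_3 d M ^+ 3 = euler 'F_3 (3 * d) M.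
Proof.
rewrite polyF3_cube /euler rmorph_prod; apply: eq_bigr => i _ /=.
by rewrite comp_polyB comp_polyC comp_Xn_poly -exprM mulnA.
Qed.

(** * Generating function of multicolored partitions *)

Lemma multicolored_partitions_coef (R : comNzRingType) r s n :
  (a r s n)%:R = (\prod_(p : colored_part r s n)
     \sum_(j < n.+1) 'X^(j * part_size p) : {poly R})`_n.
Proof.
rewrite bigA_distr_bigA /= coef_sum /a -sum1_card natr_sum.
rewrite [LHS]big_mkcond; apply: eq_bigr => m _ /=.
rewrite -expr_sum coefXn inE eq_sym.
by case: ifP.
Qed.

Lemma multicolored_partitions_gf (F : fieldType) r s n :
  eqX n.+1 ((\prod_(p : colored_part r s n) \sum_(j < n.+1) 'X^(j * part_size p))
    * \prod_(i < n) (1 - 'X^(i.+1)) ^+ num_colors r s i.+1) (1 : {poly F}).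
Proof.
have -> : \prod_(i < n) (1 - 'X^(i.+1)) ^+ num_colors r s i.+1 =
    \prod_(p : colored_part r s n) (1 - 'X^(part_size p)) :> {poly F}.
  transitivity (\prod_(i < n) \prod_(c < num_colors r s i.+1) (1 - 'X^(i.+1)) :
      {poly F}).
    by apply: eq_bigr => i _; rewrite prodr_const card_ord.
  by rewrite sig_big_dep.
rewrite -big_split.
apply: (@eqX_trans _ _ (\prod_(p : colored_part r s n) 1));
  last by rewrite big1 ?eqX_refl.
apply: eqX_prod => p _ /=.
(* The geometric sum telescopes, and its defect has degree at least [n + 1] because part sizes are
   positive. *)
have -> : (\sum_(j < n.+1) 'X^(j * part_size p)) * (1 - 'X^(part_size p))
    = 1 - 'X^(part_size p * n.+1) :> {poly F}.
  rewrite exprM -[1 in RHS](expr1n _ n.+1) subrXX mulrC; congr (_ * _).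
  by apply: eq_bigr => j _; rewrite expr1n mul1r mulnC exprM.
by apply: eqX_1subXn; rewrite leq_pmull.
Qed.

(** * Vanishing coefficients in characteristic 3 *)

Lemma theta01_coef M i : i = 2 %[mod 3] -> (theta 'F_3 0 1 (3 * M).+1)`_i = 0.
Proof.
(* By the trisection every exponent of [psi] is 1 modulo 9 or a multiple of 3. *)
move=> i2; rewrite theta_trisection coefD coefXM !coef_comp_poly_Xn //.
have -> : (3 %| i)%N = false by lia.
have -> : (9 %| i.-1)%N = false by lia.
by rewrite if_same addr0.
Qed.

Section Modulo3.

Variables N M : nat.
Hypothesis le_NM : (N <= M)%N.

Let f1 := euler 'F_3 1 (3 * M).
Let f2 := euler 'F_3 2 (3 * M).
Let psi := theta 'F_3 0 1 (3 * M).+1.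
Let B := theta 'F_3 1 2 M + theta 'F_3 2 1 M.

Let psi_f1 : eqX N (psi * f1) (2%:R * f2 ^+ 2).
Proof. by apply: theta01_euler; lia. Qed.

Let f1_neq0 : f1`_0 != 0. Proof. by rewrite euler0 ?oner_eq0. Qed.
Let f2_neq0 : f2`_0 != 0. Proof. by rewrite euler0 ?oner_eq0. Qed.

(** After multiplication by [f1], both sides become [2 f1^6 f2^2], since [f_6 = f2^3] and
    [f_3 = f1^3] in characteristic 3. *)
Lemma theta12_theta01 : eqX N (B * f2 * f2 ^+ 3) (psi * (f1 ^+ 2) ^+ 3).
Proof.
apply: (eqX_cancel f1_neq0).
have tail d : (0 < d)%N -> eqX N (euler 'F_3 (3 * d) M) (euler 'F_3 d (3 * M) ^+ 3).
  by move=> d_gt0; rewrite euler_cube; apply: euler_tail; nia.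
apply: (@eqX_trans _ _ (f2 * (B * f1 * euler 'F_3 6 M))).
  have -> : f1 * (B * f2 * f2 ^+ 3) = f2 * (B * f1 * f2 ^+ 3) by ring.
  by apply/eqXMl/eqXMl/eqX_sym/(tail 2).
apply: (@eqX_trans _ _ (f2 * (2%:R * euler 'F_3 3 M ^+ 2 * f2))).
  exact/eqXMl/theta12_euler.
apply: (@eqX_trans _ _ (f2 * (2%:R * (f1 ^+ 3) ^+ 2 * f2))).
  by apply/eqXMl/eqXM; [apply/eqXMl/eqXX/(tail 1)|apply: eqX_refl].
have -> : f2 * (2%:R * (f1 ^+ 3) ^+ 2 * f2) = f1 ^+ 6 * (2%:R * f2 ^+ 2) by ring.
have -> : f1 * (psi * (f1 ^+ 2) ^+ 3) = f1 ^+ 6 * (psi * f1) by ring.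
exact/eqXMl/eqX_sym.
Qed.

Lemma theta12_coef i : (i < N)%N -> i = 2 %[mod 3] -> (B * f2)`_i = 0.
Proof.
have := theta12_theta01; rewrite [f2 ^+ 3]polyF3_cube => e.
apply: (coef_div_comp_Xn _ f2_neq0 e) => // j _ j2.
rewrite polyF3_cube; apply: (coef_mul_comp_Xn _ _ _ j2) => //.
exact: theta01_coef.
Qed.

(** The product is ['X] times a series in ['X^3], plus [f2 * B] at ['X^3]. Only the second term
    reaches exponent [i], through coefficient [i / 3], which is 2 modulo 3. *)
Lemma f2_cube_theta01_coef i : (i < N)%N -> i = 6 %[mod 9] ->
  (f2 ^+ 3 * psi)`_i = 0.
Proof.
move=> lt_iN i6; rewrite /psi theta_trisection -/B mulrDr coefD.
rewrite (polyF3_cube f2) -comp_polyM coef_comp_poly_Xn //.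
have -> : (3 %| i)%N by lia.
rewrite [f2 * B]mulrC theta12_coef ?addr0; try lia.
have -> : theta 'F_3 0 1 M \Po 'X^9 = (theta 'F_3 0 1 M \Po 'X^3) \Po 'X^3.
  by rewrite -comp_polyA comp_Xn_poly -exprM.
rewrite mulrCA -comp_polyM coefXM coef_comp_poly_Xn //.
have -> : (3 %| i.-1)%N = false by lia.
by rewrite if_same.
Qed.

Lemma coef_quotient (G E : {poly 'F_3}) : E`_0 != 0 ->
  eqX N (G * (E ^+ 9 * f1 * f2 ^+ 4)) 1 ->
  forall i, (i < N)%N -> i = 6 %[mod 9] -> G`_i = 0.
Proof.
move=> E0 e i lt_iN i6.
have Ef2 : (E * f2)`_0 != 0 by rewrite -horner_coef0 hornerM !horner_coef0 mulf_neq0.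
have e2 : eqX N (2%:R * G * (E * f2) ^+ 9) (f2 ^+ 3 * psi).
  apply: (eqX_cancel f1_neq0).
  (* The multiplier [2 f2^5] completes [f2^4] to a ninth power and turns the right side into
     [f2^3 psi f1]. *)
  apply: (@eqX_trans _ _ (2%:R * f2 ^+ 5 * 1)).
    have -> : f1 * (2%:R * G * (E * f2) ^+ 9) =
      2%:R * f2 ^+ 5 * (G * (E ^+ 9 * f1 * f2 ^+ 4)) by ring.
    exact: eqXMl.
  have -> : 2%:R * f2 ^+ 5 * 1 = f2 ^+ 3 * (2%:R * f2 ^+ 2) by ring.
  have -> : f1 * (f2 ^+ 3 * psi) = f2 ^+ 3 * (psi * f1) by ring.
  exact/eqXMl/eqX_sym.
move: e2; rewrite polyF3_exp9 => e2.
have := coef_div_comp_Xn (isT : (0 < 9)%N) Ef2 e2 _ lt_iN i6.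
have -> : 2%:R * G = - G.
  by rewrite -[LHS]subr0 -(mul0r G) -polyF3_3; ring.
rewrite coefN => h; apply/eqP; rewrite -oppr_eq0; apply/eqP/h.
exact: f2_cube_theta01_coef.
Qed.

End Modulo3.

(** * Specialisation to the given numbers of colors *)

Lemma prod_even_parts (R : comNzRingType) (g : nat -> R) n :
  \prod_(i < n) (if odd i then g i.+1 else 1) = \prod_(i < n./2) g (2 * i.+1)%N.
Proof.
elim: n => [|n IHn]; first by rewrite !big_ord0.
rewrite big_ord_recr /= IHn uphalf_half; case: ifP => odd_n.
  rewrite add1n big_ord_recr /=; congr (_ * g _).
  by have := odd_double_half n; rewrite odd_n; lia.
by rewrite mulr1.
Qed.

(** Beyond multiples of 9, every size has one color, giving [f_1], and even sizes have four more,
    giving [f_2^4]. *)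
Lemma prod_num_colors (F : fieldType) u v n :
  \prod_(i < n) (1 - 'X^(i.+1)) ^+ num_colors (9 * u + 5) (9 * v + 1) i.+1 =
  (\prod_(i < n) (1 - 'X^(i.+1)) ^+ num_colors u v i.+1) ^+ 9
    * euler F 1 n * euler F 2 n./2 ^+ 4.
Proof.
rewrite /euler -(prod_even_parts (fun i => 1 - 'X^i)) -!prodrXl -!big_split /=.
apply: eq_bigr => i _; rewrite /num_colors /= mul1n.
case: (odd i); rewrite /= exprD mulnC exprM; last by rewrite expr1n mulr1.
by rewrite -mulrA -exprS.
Qed.

Lemma natr_F3_eq0 m : m%:R = 0 :> 'F_3 -> m = 0 %[mod 3].
Proof. by move/(congr1 val) => /=; rewrite val_Fp_nat. Qed.

Local Close Scope ring_scope.

Theorem theorem1p11 (n j k : nat) (hjk : j <= k) :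
  a (9 * (k - j) + 5) (9 * k + 1) (9 * n + 6) = 0 %[mod 3].
Proof.
apply: natr_F3_eq0; rewrite multicolored_partitions_coef.
set d := 9 * n + 6.
have := multicolored_partitions_gf 'F_3 (9 * (k - j) + 5) (9 * k + 1) d.
set G := (\prod_(p : _) _)%R; rewrite prod_num_colors; set E := (\prod_(i < d) _)%R.
(* Precision [d.+1] is what covers coefficient [d]. *)
move=> e; apply: (@coef_quotient d.+1 d.+1 _ G E) => //.
- rewrite -horner_coef0 horner_prod prodf_seq_neq0; apply/allP => i _ /=.
  by rewrite !hornerE expr0n subr0 expr1n oner_eq0.
(* The Euler products differ in length only, which does not matter below degree [d.+1]. *)
- apply: eqX_trans e; apply/eqXMl/eqXM; first apply/eqXMl.
    by apply: euler_tail; lia.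
  by apply/eqXX/euler_tail; lia.
by rewrite /d; lia.
Qed.
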